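(* Let $k^*$ be a local optimal solution of the MPEC. Suppose $\mathcal{J}$ is tangentially convex at $k^*$ and locally Lipschitz at $k^*$. Assume that the generalized standard Abadie constraint qualification (GS-ACQ) holds at $k^*$ and that the cone $$\Delta=\mathrm{cone}\,A_\ell+\mathrm{cone}\,A_\hbar+\mathrm{cone}\,G_\Theta+\mathrm{cone}\,H_\Upsilon+\mathrm{cone}\,(GH)_\Omega$$ is closed. Then $k^*$ is a GS-stationary point.
   Context: **Tangential convexity.** A function $f:\mathbb{R}^n\to\mathbb{R}$ is tangentially convex at $k$ if for every $d\in\mathbb{R}^n$ the one-sided directional derivative $f'(k,d)=\lim_{h\downarrow 0}\frac{f(k+hd)-f(k)}{h}$ exists and is finite, and $d\mapsto f'(k,d)$ is convex. Its tangential subdifferential at $k$ is $\partial^T f(k)=\{\xi\in\mathbb{R}^n:\langle \xi,d\rangle\le f'(k,d)\ \forall d\in\mathbb{R}^n\}$ (a nonempty compact convex set with $f'(k,d)=\max_{\xi\in\partial^T f(k)}\langle\xi,d\rangle$). Wherever $\partial^T(-f)(k)$ is written, $-f$ is assumed tangentially convex at $k$. **The problem.** MPEC: minimize $\mathcal{J}(k)$ subject to $\ell(k)\le 0$, $\hbar(k)=0$, $G(k)\ge 0$, $H(k)\ge 0$, $\langle G(k),H(k)\rangle=0$, where $\mathcal{J}:\mathbb{R}^n\to\mathbb{R}$, $\ell:\mathbb{R}^n\to\mathbb{R}^p$, $\hbar:\mathbb{R}^n\to\mathbb{R}^q$, $G,H:\mathbb{R}^n\to\mathbb{R}^m$; all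 (component) functions are tangentially convex at $k^*$. $K$ is the feasible set. For $k^*\in K$: $I_\ell=\{i:\ell_i(k^* )=0\}$, $\Theta=\{i:G_i(k^* )=0,H_i(k^* )>0\}$, $\Omega=\{i:G_i(k^* )=0,H_i(k^* )=0\}$, $\Upsilon=\{i:G_i(k^* )>0,H_i(k^* )=0\}$. Standing assumption: $\Omega\neq\emptyset$. **Sets.** For $A\subseteq\mathbb{R}^n$, $A^-=\{u:\langle u,a\rangle\le 0\ \forall a\in A\}$ (so $\emptyset^-=\mathbb{R}^n$), and $\mathrm{cone}\,A$ is the convex cone generated by $A$, always including the origin (so $\mathrm{cone}\,\emptyset=\{0\}$). Put - $A_\ell=\bigcup_{i\in I_\ell}\partial^T\ell_i(k^* )$, - $A_\hbar=\bigcup_{i=1}^q\partial^T\hbar_i(k^* )\cup\partial^T(-\hbar_i)(k^* )$, - $G_\Theta=\bigcup_{i\in\Theta}\partial^TG_i(k^* )\cup\partial^T(-G_i)(k^* )$, - $H_\Upsilon=\bigcup_{i\in\Upsilon}\partial^TH_i(k^* )\cup\partial^T(-H_i)(k^* )$, - $(GH)_\Omega=\bigcup_{i\in\Omega}\partial^T(-G_i)(k^* )\cup\partial^T(-H_i)(k^* )$, - $\Pi(k^* )=A_\ell^-\cap A_\hbar^-\cap G_\Theta^-\cap H_\Upsilon^-\cap(GH)_\Omega^-$. The contingent cone is $T(K,k^* )=\{u\in\mathbb{R}^n:\exists\, t_z\downarrow 0,\ u_z\to u\text{ with }k^*+t_zu_z\in K\ \forall z\in\mathbb{N}\}$. **GS-ACQ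 at $k^*$:** all constraint functions are tangentially convex at $k^*$, at least one of the polar sets used in the definition of $\Pi(k^* )$ is nonempty, and $\Pi(k^* )\subset T(K,k^* )$. **GS-stationary point:** a feasible point $k^*$ for which there are $\lambda=(\lambda^\ell,\lambda^\hbar,\lambda^G,\lambda^H)\in\mathbb{R}^{p+q+2m}$ and $\mu=(\mu^\hbar,\mu^G,\mu^H)\in\mathbb{R}^{q+2m}$ with $$0\in\partial^T\mathcal{J}(k^* )+\sum_{i\in I_\ell}\lambda_i^\ell\partial^T\ell_i(k^* )+\sum_{j=1}^q[\lambda_j^\hbar\partial^T\hbar_j(k^* )+\mu_j^\hbar\partial^T(-\hbar_j)(k^* )]+\sum_{i=1}^m[\lambda_i^G\partial^T(-G_i)(k^* )+\lambda_i^H\partial^T(-H_i)(k^* )]+\sum_{i=1}^m[\mu_i^G\partial^TG_i(k^* )+\mu_i^H\partial^TH_i(k^* )],$$ $\lambda_i^\ell\ge0$ ($i\in I_\ell$), $\lambda_j^\hbar,\mu_j^\hbar\ge0$ ($j=1,\dots,q$), $\lambda_i^G,\lambda_i^H,\mu_i^G,\mu_i^H\ge0$ ($i=1,\dots,m$), $\mu_i^G=\lambda_i^G=0$ for $i\in\Upsilon$, $\mu_i^H=\lambda_i^H=0$ for $i\in\Theta$, and $\mu_i^G=\mu_i^H=0$ for all $i\in\Omega$. Terms with zero multiplier are $\{0\}$. *)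

(* Defs.v *)
From HB Require Import structures.
From mathcomp Require Import all_boot all_order all_algebra.
From mathcomp Require Import all_classical all_reals all_analysis.
Import Order.TTheory GRing.Theory Num.Theory.
Import numFieldNormedType.Exports.

Set Implicit Arguments.
Unset Strict Implicit.
Unset Printing Implicit Defensive.

Local Open Scope classical_set_scope.
Local Open Scope ring_scope.

(* R^n is 'rV[R]_n. Its library norm is the sup norm; the notions below only
   use the topology and Lipschitz continuity, which are insensitive to that
   choice. The Euclidean inner product is dotv. *)

Section Vectors.
Context {R : realType} {n : nat}.
Implicit Types (A B C : set 'rV[R]_n) (u v : 'rV[R]_n).

Definition dotv u v : R := \sum_(i < n) u 0 i * v 0 i.

Definition polar A : set 'rV[R]_n :=
  [set u | forall a, A a -> dotv u a <= 0].

Definition convex_cone C : Prop :=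
  convex_set C /\ forall (c : R) x, 0 < c -> C x -> C (c *: x).

Definition cone A : set 'rV[R]_n := smallest convex_cone (0 |` A).

Definition sumset A B : set 'rV[R]_n := [set a + b | a in A & b in B].

(* The case split matters when A is empty: 0 * A is {0} even then. *)
Definition scaleset (c : R) A : set 'rV[R]_n :=
  if c == 0 then [set 0] else [set c *: a | a in A].

(* t_z \downarrow 0 is read as: positive and convergent to 0 (not necessarily
   monotone). *)
Definition contingent_cone (K : set 'rV[R]_n) (k : 'rV[R]_n) : set 'rV[R]_n :=
  [set u | exists (t : nat -> R) (v : nat -> 'rV[R]_n),
    [/\ forall z, 0 < t z, t z @[z --> \oo] --> 0, v z @[z --> \oo] --> u &
        forall z, K (k + t z *: v z)]].

End Vectors.

Notation "\msum_ ( i < N | P ) F" :=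
  (\big[sumset/[set 0]]_(i < N | P) F)
  (at level 41, F at level 41, i, N at level 50,
   format "'[' \msum_ ( i  <  N  |  P ) '/  '  F ']'") : classical_set_scope.
Notation "\msum_ ( i < N ) F" :=
  (\big[sumset/[set 0]]_(i < N) F)
  (at level 41, F at level 41, i, N at level 50,
   format "'[' \msum_ ( i  <  N ) '/  '  F ']'") : classical_set_scope.

Section TangentialConvexity.
Context {R : realType} {n : nat}.
Implicit Types (f : 'rV[R]_n -> R) (k d : 'rV[R]_n).

Definition diff_quot f k d (h : R) : R := (f (k + h *: d) - f k) / h.

Definition dir_deriv f k d : R := lim (diff_quot f k d h @[h --> 0^'+]).

Definition tangentially_convex f k : Prop :=
  (forall d, cvg (diff_quot f k d h @[h --> 0^'+])) /\
  convex_function [set: convex_lmodType 'rV[R]_n] (dir_deriv f k).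

Definition tan_subdiff f k : set 'rV[R]_n :=
  [set xi | forall d, dotv xi d <= dir_deriv f k d].

Definition locally_lipschitz_at f k : Prop :=
  exists2 U, nbhs k U & [lipschitz (f x : R^o) | x in U].

End TangentialConvexity.

Section MPEC.
Context {R : realType} {n p q m : nat}.

(* minimize objF subject to
   ineqF <= 0, eqF = 0, compG >= 0, compH >= 0, <compG, compH> = 0 *)
Record mpec : Type := Mpec {
  objF : 'rV[R]_n -> R;
  ineqF : 'rV[R]_n -> 'rV[R]_p;
  eqF : 'rV[R]_n -> 'rV[R]_q;
  compG : 'rV[R]_n -> 'rV[R]_m;
  compH : 'rV[R]_n -> 'rV[R]_m }.

Definition coordf {N} (F : 'rV[R]_n -> 'rV[R]_N) (i : 'I_N)
  : 'rV[R]_n -> R := fun x => F x 0 i.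

Variable P : mpec.
Implicit Type k : 'rV[R]_n.

Definition feasible : set 'rV[R]_n :=
  [set x | [/\ forall i, ineqF P x 0 i <= 0,
               eqF P x = 0,
               forall i, 0 <= compG P x 0 i,
               forall i, 0 <= compH P x 0 i &
               dotv (compG P x) (compH P x) = 0]].

Definition local_solution k : Prop :=
  feasible k /\ \forall x \near k, feasible x -> objF P k <= objF P x.

Definition I_ell k : set 'I_p := [set i | ineqF P k 0 i = 0].
Definition Theta k : set 'I_m :=
  [set i | compG P k 0 i = 0 /\ 0 < compH P k 0 i].
Definition Omega k : set 'I_m :=
  [set i | compG P k 0 i = 0 /\ compH P k 0 i = 0].
Definition Upsilon k : set 'I_m :=
  [set i | 0 < compG P k 0 i /\ compH P k 0 i = 0].

Definition constraints_tangentially_convex k : Prop :=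
  [/\ forall i, tangentially_convex (coordf (ineqF P) i) k,
      forall i, tangentially_convex (coordf (eqF P) i) k,
      forall i, tangentially_convex (coordf (compG P) i) k &
      forall i, tangentially_convex (coordf (compH P) i) k].

(* The convention that -f is tangentially convex at k whenever the tangential
   subdifferential of -f at k is used. *)
Definition negated_tangentially_convex k : Prop :=
  [/\ forall i, tangentially_convex (\- coordf (eqF P) i) k,
      forall i, (Theta k `|` Omega k) i ->
        tangentially_convex (\- coordf (compG P) i) k &
      forall i, (Upsilon k `|` Omega k) i ->
        tangentially_convex (\- coordf (compH P) i) k].

Definition A_ell k : set 'rV[R]_n :=
  \bigcup_(i in I_ell k) tan_subdiff (coordf (ineqF P) i) k.

Definition A_hbar k : set 'rV[R]_n :=
  \bigcup_(i : 'I_q) (tan_subdiff (coordf (eqF P) i) k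
                      `|` tan_subdiff (\- coordf (eqF P) i) k).

Definition G_Theta k : set 'rV[R]_n :=
  \bigcup_(i in Theta k) (tan_subdiff (coordf (compG P) i) k
                          `|` tan_subdiff (\- coordf (compG P) i) k).

Definition H_Upsilon k : set 'rV[R]_n :=
  \bigcup_(i in Upsilon k) (tan_subdiff (coordf (compH P) i) k
                            `|` tan_subdiff (\- coordf (compH P) i) k).

Definition GH_Omega k : set 'rV[R]_n :=
  \bigcup_(i in Omega k) (tan_subdiff (\- coordf (compG P) i) k
                          `|` tan_subdiff (\- coordf (compH P) i) k).

Definition linearized_cone k : set 'rV[R]_n :=
  polar (A_ell k) `&` polar (A_hbar k) `&` polar (G_Theta k)
  `&` polar (H_Upsilon k) `&` polar (GH_Omega k).

Definition GS_ACQ k : Prop :=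
  [/\ constraints_tangentially_convex k,
      [\/ polar (A_ell k) !=set0,
          polar (A_hbar k) !=set0,
          polar (G_Theta k) !=set0 |
          polar (H_Upsilon k) !=set0 \/ polar (GH_Omega k) !=set0] &
      linearized_cone k `<=` contingent_cone feasible k].

Definition Delta k : set 'rV[R]_n :=
  sumset (sumset (sumset (sumset (cone (A_ell k)) (cone (A_hbar k)))
    (cone (G_Theta k))) (cone (H_Upsilon k))) (cone (GH_Omega k)).

Definition stationarity_set k
    (laml : 'rV[R]_p) (lamh muh : 'rV[R]_q) (lamG lamH muG muH : 'rV[R]_m)
    : set 'rV[R]_n :=
  sumset (sumset (sumset (sumset
    (tan_subdiff (objF P) k)
    (\msum_(i < p | i \in I_ell k)
       scaleset (laml 0 i) (tan_subdiff (coordf (ineqF P) i) k)))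
    (\msum_(j < q)
       sumset (scaleset (lamh 0 j) (tan_subdiff (coordf (eqF P) j) k))
              (scaleset (muh 0 j) (tan_subdiff (\- coordf (eqF P) j) k))))
    (\msum_(i < m)
       sumset (scaleset (lamG 0 i) (tan_subdiff (\- coordf (compG P) i) k))
              (scaleset (lamH 0 i) (tan_subdiff (\- coordf (compH P) i) k))))
    (\msum_(i < m)
       sumset (scaleset (muG 0 i) (tan_subdiff (coordf (compG P) i) k))
              (scaleset (muH 0 i) (tan_subdiff (coordf (compH P) i) k))).

Definition GS_stationary k : Prop :=
  feasible k /\
  exists (laml : 'rV[R]_p) (lamh : 'rV[R]_q) (lamG lamH : 'rV[R]_m)
         (muh : 'rV[R]_q) (muG muH : 'rV[R]_m),
    stationarity_set k laml lamh muh lamG lamH muG muH 0 /\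
    [/\ forall i, I_ell k i -> 0 <= laml 0 i,
        forall j, 0 <= lamh 0 j /\ 0 <= muh 0 j &
        forall i, [/\ 0 <= lamG 0 i, 0 <= lamH 0 i,
                      0 <= muG 0 i & 0 <= muH 0 i]] /\
    [/\ forall i, Upsilon k i -> muG 0 i = 0 /\ lamG 0 i = 0,
        forall i, Theta k i -> muH 0 i = 0 /\ lamH 0 i = 0 &
        forall i, Omega k i -> muG 0 i = 0 /\ muH 0 i = 0].

End MPEC.

Arguments mpec : clear implicits.

(* Main.v *)
(* The directional derivative p of J at k is sublinear, and it is nonnegative on
   the contingent cone of the feasible set because J is locally Lipschitz and k
   is a local minimizer. By GS-ACQ, p is thus nonnegative on Pi(k), which
   contains the polar of Delta. If -dJ(k) and Delta were disjoint, a strict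
   separation of the compact convex set -dJ(k) from the closed convex cone Delta
   would give u in the polar of Delta with <xi, u> < 0 for all xi in dJ(k);
   since p(u) is the maximum of <xi, u> over dJ(k), this contradicts
   p(u) >= 0. Hence some xi in dJ(k) has -xi in Delta, and the multipliers are
   read off a decomposition of -xi in Delta: each of the convex cones involved
   is generated by finitely many convex sets, so one term per set suffices. *)

Require Import Defs.
From mathcomp Require Import all_boot all_order all_algebra.
From mathcomp Require Import all_classical all_reals all_analysis.
From mathcomp Require Import ring lra.

Import Order.TTheory GRing.Theory Num.Theory.
Import numFieldNormedType.Exports.

Set Implicit Arguments.
Unset Strict Implicit.
Unset Printing Implicit Defensive.

Local Open Scope classical_set_scope.
Local Open Scope ring_scope.

(** * Sublinear functionals *)

Section Sublinear.
Context {R : realType} {V : lmodType R}.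
Implicit Types (p q : V -> R) (x y u v : V) (s : seq V).

Definition sublinear p :=
  (forall x y, p (x + y) <= p x + p y) /\
  (forall (c : R) x, 0 < c -> p (c *: x) <= c * p x).

(** The reverse inequality is the assumed one with [c^-1] at [c *: x]. *)
Lemma sublinearZ p (c : R) x : sublinear p -> 0 < c -> p (c *: x) = c * p x.
Proof.
move=> [_ pZ] c0; apply/eqP; rewrite eq_le pZ//=.
have := pZ c^-1 (c *: x); rewrite invr_gt0 => /(_ c0).
by rewrite scalerK ?gt_eqF// mulrC ler_pdivlMr// mulrC.
Qed.

Lemma sublinear0 p : sublinear p -> p 0 = 0.
Proof.
move=> ps; have := sublinearZ 0 ps (ltr0n R 2).
by rewrite scaler0 => p0; lra.
Qed.

Lemma sublinearN_ge0 p x : sublinear p -> 0 <= p x + p (- x).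
Proof. by move=> ps; rewrite -(sublinear0 ps) -(subrr x); exact: ps.1. Qed.

(** A sublinear minorant is squeezed along a direction where [p] is odd, so further linearizations
    keep the values already fixed. *)
Lemma sublinear_odd p q u : sublinear p -> sublinear q ->
  (forall x, q x <= p x) -> p (- u) = - p u -> q u = p u /\ q (- u) = - q u.
Proof.
move=> ps qs qp pu; have := sublinearN_ge0 u qs.
by have := qp u; have := qp (- u); rewrite pu; split; lra.
Qed.

(* [q] is the directional derivative of [p] at [v]. *)
Lemma sublinear_linearize p v : sublinear p ->
  exists q, [/\ sublinear q, forall x, q x <= p x, q v = p v & q (- v) = - q v].
Proof.
move=> ps.
have pZ0 (t : R) x : 0 <= t -> p (t *: x) = t * p x.
  rewrite le_eqVlt => /predU1P[<-|t0]; last exact: sublinearZ.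
  by rewrite scale0r mul0r sublinear0.
(* For [t > 0] and [s = 1 / t], the element is the difference quotient [(p (v + s *: x) - p v) / s];
   [t = 0] gives [p x]. *)
pose Q x := [set p (x + t *: v) - t * p v | t in [set t | 0 <= t]].
pose q x := inf (Q x).
have Qlb x (t : R) : 0 <= t -> - p (- x) <= p (x + t *: v) - t * p v.
  move=> t0; have := ps.1 (- x) (x + t *: v).
  by rewrite addKr pZ0//; lra.
have q_le x (t : R) : 0 <= t -> q x <= p (x + t *: v) - t * p v.
  move=> t0; apply: ge_inf; last by exists t.
  by exists (- p (- x)) => _ [t' t'0 <-]; exact: Qlb.
have le_q x (a : R) :
    (forall t : R, 0 <= t -> a <= p (x + t *: v) - t * p v) -> a <= q x.
  move=> aQ; apply: lb_le_inf; last by move=> _ [t t0 <-]; exact: aQ.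
  by exists (p (x + 0 *: v) - 0 * p v); exists 0 => //=.
have qp x : q x <= p x.
  by have := q_le x 0 (lexx 0); rewrite scale0r mul0r addr0 subr0.
have qs : sublinear q.
  split=> [x y|c x c0].
    (* The parameters used for [x] and [y] are independent, and their sum serves for [x + y]. *)
    rewrite -lerBlDr; apply: (le_q) => a a0.
    rewrite lerBlDr -lerBlDl; apply: le_q => t t0.
    have := q_le (x + y) (a + t) (addr_ge0 a0 t0).
    have := ps.1 (x + a *: v) (y + t *: v).
    rewrite addrACA -scalerDl; lra.
  rewrite mulrC -ler_pdivrMr//; apply: le_q => t t0; rewrite ler_pdivrMr//.
  have := q_le (c *: x) (c * t) (mulr_ge0 (ltW c0) t0).
  by rewrite -scalerA -scalerDr (sublinearZ _ ps)//; lra.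
(* Taking [t = 1] cancels [- v]. As [q v + q (- v)] is nonnegative, this forces equality at both [v]
   and [- v]. *)
have qNv : q (- v) <= - p v.
  by have := q_le (- v) 1 ler01; rewrite scale1r addNr sublinear0// mul1r sub0r.
have := sublinearN_ge0 v qs; have := qp v.
by exists q; split => //; lra.
Qed.

Lemma sublinear_linearize_seq p s : sublinear p ->
  exists q, [/\ sublinear q, forall x, q x <= p x &
    forall v, v \in s -> q (- v) = - q v].
Proof.
move=> ps; elim: s => [|v s [q [qs qp qN]]]; first by exists p.
have [r [rs rq _ rN]] := sublinear_linearize v qs.
exists r; split=> // [x|u]; first exact: le_trans (qp x).
rewrite inE => /predU1P[->//|us].
by have [] := sublinear_odd qs rs rq (qN _ us).
Qed.

End Sublinear.

(** * Euclidean geometry of row vectors *)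

Section Dotv.
Context {R : realType} {n : nat}.
Implicit Types (u v w : 'rV[R]_n) (A B C D S : set 'rV[R]_n).

Lemma dotvC u v : dotv u v = dotv v u.
Proof. by apply: eq_bigr => i _; rewrite mulrC. Qed.

Lemma dotvDl u v w : dotv (u + v) w = dotv u w + dotv v w.
Proof. by rewrite -big_split; apply: eq_bigr => i _; rewrite mxE mulrDl. Qed.

Lemma dotvDr u v w : dotv w (u + v) = dotv w u + dotv w v.
Proof. by rewrite dotvC dotvDl !(dotvC w). Qed.

Lemma dotvZl (c : R) u v : dotv (c *: u) v = c * dotv u v.
Proof. by rewrite mulr_sumr; apply: eq_bigr => i _; rewrite mxE mulrA. Qed.

Lemma dotvZr (c : R) u v : dotv v (c *: u) = c * dotv v u.
Proof. by rewrite dotvC dotvZl dotvC. Qed.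

Lemma dotvNl u v : dotv (- u) v = - dotv u v.
Proof. by rewrite -scaleN1r dotvZl mulN1r. Qed.

Lemma dotvNr u v : dotv v (- u) = - dotv v u.
Proof. by rewrite dotvC dotvNl dotvC. Qed.

Lemma dotv_delta u i : dotv u (delta_mx 0 i) = u 0 i.
Proof.
rewrite /dotv (bigD1 i)//= mxE !eqxx mulr1 big1 ?addr0// => j ji.
by rewrite mxE (negPf ji) andbF mulr0.
Qed.

Lemma sqr_coord_le_dotv u i : u 0 i ^+ 2 <= dotv u u.
Proof.
rewrite /dotv (bigD1 i)//= -expr2 lerDl sumr_ge0// => j _.
by rewrite -expr2 sqr_ge0.
Qed.

Lemma dotv_ge0 u : 0 <= dotv u u.
Proof. by apply: sumr_ge0 => j _; rewrite -expr2 sqr_ge0. Qed.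

Lemma dotv_eq0 u : dotv u u = 0 -> u = 0.
Proof.
move=> u0; apply/rowP => i; rewrite mxE; apply/eqP; rewrite -sqrf_eq0.
by rewrite eq_le sqr_ge0 -u0 sqr_coord_le_dotv.
Qed.

Lemma norm_le_coord u (M : R) :
  0 <= M -> (forall i, `|u 0 i| <= M) -> `|u| <= M.
Proof.
move=> M0 uM; rewrite [leLHS]/Num.norm /= mx_normrE.
by apply/bigmax_leP; split=> // -[a i] _ /=; rewrite ord1.
Qed.

Lemma continuous_dotv (T : topologicalType) (f g : T -> 'rV[R]_n) :
  continuous f -> continuous g -> continuous (fun x => dotv (f x) (g x)).
Proof.
move=> fc gc x; rewrite /dotv.
have coordc h i :
    continuous h -> continuous (fun y : T => (h y : 'rV[R]_n) 0 i).
  move=> hc y; exact: (continuous_comp (hc y) (@coord_continuous _ _ _ 0 i _)).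
apply: cvg_big => [|i _]; first exact: add_continuous.
by apply: cvgM; exact: coordc.
Qed.

(* Linearizing [p] along [d] first and along the standard basis afterwards
   turns it into a linear form that still takes the value [p d] at [d]. *)
Lemma sublinear_support (p : 'rV[R]_n -> R) d : sublinear p ->
  exists2 xi, (forall x, dotv xi x <= p x) & dotv xi d = p d.
Proof.
move=> ps; have [q [qs qp qd qN]] := sublinear_linearize d ps.
have [r [rs rq rN]] :=
  sublinear_linearize_seq [seq delta_mx 0 i | i <- enum 'I_n] qs.
pose xi : 'rV[R]_n := \row_i r (delta_mx 0 i).
have rZ (c : R) i : r (c *: delta_mx 0 i) = c * r (delta_mx 0 i).
  have rNi : r (- delta_mx 0 i) = - r (delta_mx 0 i).
    by apply: rN; apply: map_f; rewrite mem_enum.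
  have [c0|c0|->] := ltgtP c 0; last by rewrite scale0r mul0r sublinear0.
    rewrite -{1}[c]opprK scaleNr -scalerN sublinearZ ?oppr_gt0// rNi.
    by rewrite mulrNN.
  by rewrite sublinearZ.
have r_le x : r x <= dotv xi x.
  rewrite [in leLHS](row_sum_delta x) /dotv.
  elim/big_ind2 : _ => [|a b a' b' ab ab'|i _]; first by rewrite sublinear0.
    by apply: le_trans (rs.1 _ _) _; exact: lerD.
  by rewrite rZ mxE mulrC.
(* Being below a linear form at both [x] and [- x] leaves only equality, since [r x + r (- x)] is
   nonnegative. *)
have rE x : r x = dotv xi x.
  have := r_le x; have := r_le (- x); have := sublinearN_ge0 x rs.
  by rewrite dotvNr; lra.
exists xi => [x|]; rewrite -rE; first exact: le_trans (qp x).
by rewrite -qd; have [] := sublinear_odd qs rs rq qN.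
Qed.

(** * Convex sets, convex cones and their strict separation *)

Lemma convex_setP A : convex_set A <-> forall x y (t : R), 0 <= t <= 1 ->
  A x -> A y -> A (t *: x + (1 - t) *: y).
Proof.
split=> [cA x y t /andP[t0 t1] Ax Ay|cA x y t /set_mem Ax /set_mem Ay].
  exact/set_mem/(cA _ _ (Itv01 t0 t1) (mem_set Ax) (mem_set Ay)).
by apply/mem_set/cA => //; rewrite ge0 le1.
Qed.

(** A sum is twice a midpoint. Conversely, only weights strictly between 0 and 1 need checking, so
    [C] may omit the origin. *)
Lemma convex_coneP C : convex_cone C <->
  (forall x y, C x -> C y -> C (x + y)) /\
  (forall (c : R) x, 0 < c -> C x -> C (c *: x)).
Proof.
split=> -[CD CZ]; split=> //.
  move=> x y Cx Cy.
  have -> : x + y = 2 *: (2^-1 *: x + (1 - 2^-1) *: y).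
    rewrite scalerDr !scalerA divff ?pnatr_eq0// scale1r.
    by rewrite (_ : 2 * (1 - 2^-1) = 1) ?scale1r//; field.
  by apply: CZ => //; apply: (convex_setP C).1 => //; lra.
apply/convex_setW => x y /set_mem Cx /set_mem Cy t t0 t1; apply/mem_set.
by apply: CD; apply: CZ => //; rewrite subr_gt0.
Qed.

Lemma convex_cone_cone A : convex_cone (cone A).
Proof.
apply/convex_coneP; split=> [x y Ax Ay|c x c0 Ax] B [Bc AB].
  by apply: ((convex_coneP B).1 Bc).1; [apply: Ax|apply: Ay].
by apply: ((convex_coneP B).1 Bc).2 => //; apply: Ax.
Qed.

Lemma cone0 A : cone A 0.
Proof. by apply: sub_gen_smallest; left. Qed.

Lemma sub_cone A : A `<=` cone A.
Proof. by move=> x Ax; apply: sub_gen_smallest; right. Qed.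

Lemma cone_subset A C : convex_cone C -> C 0 -> A `<=` C -> cone A `<=` C.
Proof.
by move=> Cc C0 sAC; apply: smallest_sub => // x [->//|]; exact: sAC.
Qed.

Lemma convex_cone_sumset A B :
  convex_cone A -> convex_cone B -> convex_cone (sumset A B).
Proof.
move=> /convex_coneP[AD AZ] /convex_coneP[BD BZ]; apply/convex_coneP; split.
  move=> _ _ [a Aa [b Bb <-]] [a' Aa' [b' Bb' <-]].
  by exists (a + a'); [exact: AD|exists (b + b'); [exact: BD|rewrite addrACA]].
move=> c _ c0 [a Aa [b Bb <-]].
by exists (c *: a); [exact: AZ|exists (c *: b); [exact: BZ|rewrite scalerDr]].
Qed.

Lemma sumset0 A B : A 0 -> B 0 -> sumset A B 0.
Proof. by move=> A0 B0; exists 0 => //; exists 0; rewrite ?addr0. Qed.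

Lemma sub_sumsetl A B : B 0 -> A `<=` sumset A B.
Proof. by move=> B0 a Aa; exists a => //; exists 0; rewrite ?addr0. Qed.

Lemma sub_sumsetr A B : A 0 -> B `<=` sumset A B.
Proof. by move=> A0 b Bb; exists 0 => //; exists b; rewrite ?add0r. Qed.

(** [D] may be unbounded, but a large [d'] makes [s' + d'] no shorter than [s0 + 0], so it suffices
    to minimize over a truncation of [D]. *)
Lemma closest_pair S D : compact S -> S !=set0 -> closed D -> D 0 ->
  exists s d, [/\ S s, D d & forall s' d', S s' -> D d' ->
    dotv (s + d) (s + d) <= dotv (s' + d') (s' + d')].
Proof.
move=> Sc [s0 Ss0] Dc D0.
have /ex_strict_bound_gt0[B B0 SB] := compact_bounded Sc.
(* The radius [r] is such that a [d'] of norm above [r] gives [s' + d'] norm above [m0 + 1], because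
   [B] bounds [S]. *)
pose m0 := dotv s0 s0; have m00 : 0 <= m0 := dotv_ge0 s0.
pose r := B + (m0 + 1).
pose E := D `&` [set x | `|x| <= r].
have Ec : compact E.
  apply: bounded_closed_compact.
    exists r; split; first exact: num_real.
    by move=> M rM x [_ /= /le_trans]; apply; exact: ltW.
  apply: closedI => //.
  by apply: (preimage_closed _ (@closed_le R r)) => x _; exact: norm_continuous.
have [] := @compact_EVT_min _ R
    (fun z : 'rV[R]_n * 'rV[R]_n => dotv (z.1 + z.2) (z.1 + z.2)) (S `*` E).
- by exists (s0, 0); split=> //=; split=> //=; rewrite normr0 /r; lra.
- exact: compact_setX.
- apply: continuous_subspaceT.
  by apply: continuous_dotv => z; exact: add_continuous.
move=> [s d] /set_mem[/= Ss [Dd _]] sd_min.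
exists s, d; split=> // s' d' Ss' Dd'.
have [d'r|rd'] := leP `|d'| r.
  by apply: (sd_min (s', d')); apply/mem_set.
have sdm0 : dotv (s + d) (s + d) <= m0.
  have := sd_min (s0, 0); rewrite /= addr0; apply; apply/mem_set; split=> //.
  by split=> //=; rewrite normr0 /r; lra.
apply: le_trans sdm0 _; rewrite leNgt; apply/negP => sd'm0.
have : `|s' + d'| <= m0 + 1.
  (* A coordinate whose square is at most [m0] has absolute value at most [m0 + 1]; this passes from
     Euclidean length to the sup norm. *)
  apply: norm_le_coord => [|i]; first by lra.
  have := le_trans (sqr_coord_le_dotv (s' + d') i) (ltW sd'm0).
  by rewrite -real_normK ?num_real//; nra.
have := ler_normB (s' + d') s'; rewrite addrAC subrr add0r.
by have /ltW := SB _ Ss'; rewrite /r in rd'; lra.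
Qed.

(** The shortest vector [w] of [S + D] is nonzero because [S] misses [- D], and [- w] separates:
    translating [d] inside [D] gives the polar condition, and [d' = 0] gives the strict sign on
    [S]. *)
Lemma strict_separation S D : compact S -> S !=set0 -> convex_set S ->
  closed D -> convex_cone D -> D 0 -> (forall s, S s -> ~ D (- s)) ->
  exists2 u, polar D u & forall s, S s -> dotv u s < 0.
Proof.
move=> Sc S0 /convex_setP Scv Dc Dcv D0 SD.
have [DD DZ] := (convex_coneP D).1 Dcv.
have [s [d [Ss Dd sd_min]]] := closest_pair Sc S0 Dc D0.
have [w wE] : exists w, w = s + d by exists (s + d).
have w_gt0 : 0 < dotv w w.
  rewrite lt_neqAle dotv_ge0 andbT eq_sym; apply/negP => /eqP/dotv_eq0 w0.
  by rewrite wE in w0; apply: (SD s Ss); rewrite (addr0_eq w0).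
(* First-order optimality along the segments issued from the closest point. *)
have w_le s' d' : S s' -> D d' -> dotv w w <= dotv w (s' + d').
  move=> Ss' Dd'; set z := s' + d'.
  have [y zE] : exists y, z = w + y by exists (z - w); rewrite addrC subrK.
  have wy t : 0 < t -> t <= 1 -> 0 <= 2 * dotv w y + t * dotv y y.
    move=> t0 t1.
    have := sd_min (t *: s' + (1 - t) *: s) (t *: d' + (1 - t) *: d).
    rewrite addrACA -!scalerDr -/z -wE zE.
    have -> : t *: (w + y) + (1 - t) *: w = w + t *: y.
      by rewrite scalerDr addrAC -scalerDl (addrC t) subrK scale1r.
    rewrite !(dotvDl, dotvDr, dotvZl, dotvZr) (dotvC y w) => le_ww.
    have /le_ww {}le_ww : S (t *: s' + (1 - t) *: s) by apply: Scv => //; lra.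
    have /le_ww {}le_ww : D (t *: d' + (1 - t) *: d).
      by apply: (convex_setP D).1 => //; [exact: Dcv.1|lra].
    by rewrite -(pmulr_rge0 _ t0); lra.
  suff : 0 <= dotv w y by rewrite zE dotvDr; lra.
  rewrite leNgt; apply/negP => wy0.
  have yy0 := dotv_ge0 y.
  (* This step size lies in []0, 1]] and turns [2 * dotv w y + t * dotv y y] into
     [(1 + t) * dotv w y], which is negative. *)
  pose t := - dotv w y / (dotv y y - dotv w y).
  have yyw : 0 < dotv y y - dotv w y by lra.
  have tE : t * dotv y y = - dotv w y + t * dotv w y.
    by rewrite /t; field; rewrite gt_eqF.
  have t0 : 0 < t by rewrite divr_gt0//; lra.
  have t1 : t <= 1 by rewrite ler_pdivrMr//; lra.
  by have := wy t t0 t1; rewrite tE; nra.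
exists (- w) => [d' Dd'|s' Ss'].
  have := w_le s (d + d') Ss (DD _ _ Dd Dd').
  by rewrite addrA -wE dotvDr dotvNl; lra.
have := w_le s' 0 Ss' D0.
by rewrite addr0 dotvNl; lra.
Qed.

End Dotv.

(** * Tangential subdifferentials *)

Section DirectionalDerivative.
Context {R : realType} {n : nat}.
Implicit Types (f : 'rV[R]_n -> R) (k d : 'rV[R]_n).

Lemma diff_quot_seq_cvg f k d (t : nat -> R) :
  cvg (diff_quot f k d h @[h --> 0^'+]) -> (forall z, 0 < t z) ->
  t z @[z --> \oo] --> 0 ->
  diff_quot f k d (t z) @[z --> \oo] --> dir_deriv f k d.
Proof. by move=> /cvg_at_rightP fd t0 tcvg; exact: fd. Qed.

(** Positive homogeneity is a rescaling of the step, compared along a harmonic sequence; convexity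
    at the midpoint then yields subadditivity. *)
Lemma dir_deriv_sublinear f k :
  tangentially_convex f k -> sublinear (dir_deriv f k).
Proof.
move=> [fcvg fconv].
have fZ (c : R) d : 0 < c -> dir_deriv f k (c *: d) = c * dir_deriv f k d.
  move=> c0; pose t : nat -> R := harmonic.
  have tcvg : t z @[z --> \oo] --> 0 by exact: cvg_harmonic.
  have ct0 z : 0 < c * t z by rewrite mulr_gt0// harmonic_gt0.
  have ctcvg : c * t z @[z --> \oo] --> 0 by rewrite -(mulr0 c); exact: cvgZr.
  apply: (cvg_unique (@norm_hausdorff _ R)
    (diff_quot_seq_cvg (fcvg (c *: d)) (@harmonic_gt0 R) tcvg)).
  have : c * diff_quot f k d (c * t z) @[z --> \oo] --> c * dir_deriv f k d.
    by apply: cvgMr; exact: diff_quot_seq_cvg.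
  apply: cvg_trans; apply: near_eq_cvg; apply: nearW => z.
  rewrite /diff_quot scalerA (mulrC (t z)) mulrCA; congr (_ * _).
  by rewrite invfM mulrA divff ?gt_eqF// mul1r.
split=> [x y|c x c0]; last by rewrite fZ.
have [h0 h1] : 0 <= 2^-1 :> R /\ 2^-1 <= 1 :> R by lra.
have := @fconv (Itv01 h0 h1) x y (mem_setT _) (mem_setT _).
rewrite convRE/= => fxy.
have -> : x + y = 2 *: (2^-1 *: x + (1 - 2^-1) *: y).
  rewrite scalerDr !scalerA divff ?pnatr_eq0// scale1r.
  by rewrite (_ : 2 * (1 - 2^-1) = 1) ?scale1r//; field.
rewrite fZ//.
move: fxy; set a := dir_deriv f k _; set b := dir_deriv f k x.
set c := dir_deriv f k y; rewrite /unstable.onem.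
have -> : 2^-1 * b + (1 - 2^-1) * c = (b + c) / 2 by field.
by rewrite ler_pdivlMr// mulrC.
Qed.

Lemma tan_subdiff_convex f k : convex_set (tan_subdiff f k).
Proof.
apply/convex_setP => x y t /andP[t0 t1] fx fy d; rewrite dotvDl !dotvZl.
by have := fx d; have := fy d; nra.
Qed.

(** Testing against the basis vectors and their opposites bounds every coordinate; closedness comes
    from an intersection of closed half-spaces. *)
Lemma tan_subdiff_compact f k : compact (tan_subdiff f k).
Proof.
apply: bounded_closed_compact.
  pose M := \sum_(i < n) (`|dir_deriv f k (delta_mx 0 i)| +
                          `|dir_deriv f k (- delta_mx 0 i)|).
  exists M; split; first exact: num_real.
  move=> N MN xi fxi; apply: le_trans (ltW MN).
  have M0 : 0 <= M by apply: sumr_ge0 => i _; exact: addr_ge0.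
  apply: norm_le_coord => // i.
  apply: (@le_trans _ _ (`|dir_deriv f k (delta_mx 0 i)| +
                         `|dir_deriv f k (- delta_mx 0 i)|)); last first.
    rewrite /M (bigD1 i)//= lerDl; apply: sumr_ge0 => j _; exact: addr_ge0.
  have := fxi (delta_mx 0 i); have := fxi (- delta_mx 0 i).
  rewrite dotvNr dotv_delta ler_norml => lo up.
  have := ler_norm (dir_deriv f k (- delta_mx 0 i)).
  have := ler_norm (dir_deriv f k (delta_mx 0 i)).
  have := normr_ge0 (dir_deriv f k (- delta_mx 0 i)).
  have := normr_ge0 (dir_deriv f k (delta_mx 0 i)).
  by lra.
have -> : tan_subdiff f k =
    \bigcap_d [set xi | dotv xi d <= dir_deriv f k d].
  by apply/seteqP; split=> [xi fxi d _|xi fxi d]; exact: fxi.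
apply: closed_bigI => d _.
apply: (preimage_closed _ (@closed_le R _)) => xi _.
apply: (continuous_dotv (f := id) (g := fun=> d)) => x;
  [exact: cvg_id|exact: cst_continuous].
Qed.

Lemma tan_subdiff_max f k d : tangentially_convex f k ->
  exists2 xi, tan_subdiff f k xi & dotv xi d = dir_deriv f k d.
Proof. by move=> /dir_deriv_sublinear/(sublinear_support d). Qed.

(** Increments along [v z] are eventually nonnegative by minimality, and replacing [v z] by [d]
    lowers the quotient by at most [M * |v z - d|], which tends to 0. *)
Lemma contingent_dir_deriv_ge0 f (K : set 'rV[R]_n) k d :
  locally_lipschitz_at f k -> (\forall x \near k, K x -> f k <= f x) ->
  cvg (diff_quot f k d h @[h --> 0^'+]) -> contingent_cone K k d ->
  0 <= dir_deriv f k d.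
Proof.
move=> [U kU Ulip] kmin fcvg [t [v [t0 tcvg vcvg Kv]]].
have [M _ UM] := pinfty_ex_gt (num_real 0) Ulip.
have ktv (w : nat -> 'rV[R]_n) (e : 'rV[R]_n) : w z @[z --> \oo] --> e ->
    k + t z *: w z @[z --> \oo] --> k.
  move=> we; rewrite -[X in _ --> X]addr0 -(scale0r e).
  by apply: cvgD; [exact: cvg_cst|exact: cvgZ].
have kd := ktv (fun=> d) d (cvg_cst _).
have kv := ktv _ _ vcvg.
have vd0 : - (M * `|v z - d|) @[z --> \oo] --> - (M * `|d - d|).
  by apply: cvgN; apply: cvgMr; apply: cvg_norm; apply: cvgB => //;
    exact: cvg_cst.
rewrite subrr normr0 mulr0 oppr0 in vd0.
apply: (ler_cvg_to vd0 (diff_quot_seq_cvg fcvg t0 tcvg)).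
near=> z.
rewrite /diff_quot ler_pdivlMr//.
have Ud : U (k + t z *: d) by near: z; exact: kd.
have Uv : U (k + t z *: v z) by near: z; exact: kv.
have fkv : f k <= f (k + t z *: v z).
  by move: (Kv z); near: z; exact: kv kmin.
have := UM (k + t z *: v z, k + t z *: d) (conj Uv Ud).
rewrite /= opprD addrACA subrr add0r -scalerBr normrZ gtr0_norm// => fvd.
have := le_trans (ler_norm _) fvd; lra.
Unshelve. all: by end_near. Qed.

End DirectionalDerivative.

(** * Cones generated by finitely many convex sets *)

Section ConicFamily.
Context {R : realType} {n : nat}.
Implicit Types (A B : set 'rV[R]_n) (x y : 'rV[R]_n).

(** Two terms with positive multipliers merge into one at the weighted average of their base points;
    hence one term per convex set suffices. *)
Lemma scalesetD A (c e : R) x y : convex_set A -> 0 <= c -> 0 <= e ->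
  scaleset c A x -> scaleset e A y -> scaleset (c + e) A (x + y).
Proof.
move=> /convex_setP Ac; rewrite /scaleset.
have [->|c0] := eqVneq c 0; first by rewrite add0r => _ _ ->; rewrite add0r.
have [->|e0] := eqVneq e 0.
  by rewrite addr0 (negPf c0) => _ _ + ->; rewrite addr0.
rewrite !le0r (negPf c0) (negPf e0)/= => {}c0 {}e0 [a Aa <-] [b Ab <-].
have ce0 : 0 < c + e by exact: addr_gt0.
rewrite (gt_eqF ce0); exists ((c / (c + e)) *: a + (1 - c / (c + e)) *: b).
  apply: Ac => //; apply/andP; split; first by rewrite divr_ge0// ltW.
  by rewrite ler_pdivrMr// mul1r lerDl ltW.
rewrite scalerDr !scalerA; congr (_ *: _ + _ *: _); field; by rewrite gt_eqF.
Qed.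

Lemma scalesetZ A (c e : R) x : 0 < c -> scaleset e A x ->
  scaleset (c * e) A (c *: x).
Proof.
rewrite /scaleset mulf_eq0 => c0; rewrite (gt_eqF c0)/=.
case: eqP => [_ ->|_ [a Aa <-]]; first by rewrite scaler0.
by exists a; rewrite ?scalerA.
Qed.

Context {N : nat}.
Implicit Types (D : set 'I_N) (F : 'I_N -> set 'rV[R]_n) (l : 'rV[R]_N)
  (a : 'I_N -> 'rV[R]_n).

Lemma msum_sum (P : pred 'I_N) F a : (forall i, P i -> F i (a i)) ->
  (\msum_(i < N | P i) F i) (\sum_(i < N | P i) a i).
Proof.
move=> Fa; elim/big_ind2: _ => // x A y B Ax By.
by exists x => //; exists y.
Qed.

(** A certificate of membership in a generated cone, with one multiplier per index; the multipliers
    vanish off [D], as stationarity will require. *)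
Definition conic_family D F l a := [/\ forall i, 0 <= l 0 i,
  forall i, ~ D i -> l 0 i = 0 & forall i, scaleset (l 0 i) (F i) (a i)].

(** Distinct index sets are allowed so that families from different cones can be merged. *)
Lemma conic_familyD D E F l m a b : (forall i, convex_set (F i)) ->
  conic_family D F l a -> conic_family E F m b ->
  conic_family (D `|` E) F (l + m) (fun i => a i + b i).
Proof.
move=> Fc [l0 lD Fa] [m0 mE Fb]; split=> i.
- by rewrite mxE addr_ge0.
- by move=> /not_orP[/lD li /mE mi]; rewrite mxE li mi addr0.
- by rewrite mxE; exact: scalesetD.
Qed.

(** The sums of conic families form a convex cone that contains the origin and every generator,
    hence the generated cone. *)
Lemma cone_bigcup D F x : (forall i, convex_set (F i)) ->
  cone (\bigcup_(i in D) F i) x ->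
  exists l a, conic_family D F l a /\ \sum_i a i = x.
Proof.
move=> Fc; pose C := [set \sum_i p.2 i | p in
  [set p : 'rV[R]_N * ('I_N -> 'rV[R]_n) | conic_family D F p.1 p.2]].
suff /[apply] : cone (\bigcup_(i in D) F i) `<=` C.
  by case=> -[l a] ? ?; exists l, a.
apply: cone_subset.
- apply/convex_coneP; split=> [_ _ [[l a]/= la <-] [[m b]/= mb <-]|].
    exists (l + m, fun i => a i + b i) => /=; last by rewrite big_split.
    by rewrite -(setUid D); exact: conic_familyD.
  move=> c _ c0 [[l a]/= [l0 lD la] <-].
  exists (c *: l, fun i => c *: a i) => /=; last by rewrite scaler_sumr.
  split=> i; rewrite mxE; first by rewrite mulr_ge0// ltW.
    by move=> /lD->; rewrite mulr0.
  exact: scalesetZ.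
- exists (0, fun=> 0) => /=; last by rewrite big1.
  by split=> i; rewrite mxE// /scaleset eqxx.
- move=> y [i Di Fy].
  exists (delta_mx 0 i, fun j => if j == i then y else 0) => /=.
    split=> j; rewrite mxE eqxx/=.
    + by rewrite ler0n.
    + by case: eqP => // ->.
    + rewrite /scaleset; case: (eqVneq j i) => [->|_]/=; last by rewrite eqxx.
      by rewrite oner_eq0; exists y; rewrite ?scale1r.
  by rewrite -big_mkcond big_pred1_eq.
Qed.

(** A union [F i] with [G i] need not be convex, so the cone is first split into the sum of two
    cones generated by convex sets. *)
Lemma cone_bigcupU D F G x :
  (forall i, convex_set (F i)) -> (forall i, convex_set (G i)) ->
  cone (\bigcup_(i in D) (F i `|` G i)) x ->
  exists l m a b, [/\ conic_family D F l a, conic_family D G m b &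
    \sum_i a i + \sum_i b i = x].
Proof.
move=> Fc Gc.
have /[apply] : cone (\bigcup_(i in D) (F i `|` G i)) `<=`
    sumset (cone (\bigcup_(i in D) F i)) (cone (\bigcup_(i in D) G i)).
  apply: cone_subset.
  - by apply: convex_cone_sumset; exact: convex_cone_cone.
  - by apply: sumset0; exact: cone0.
  - move=> y [i Di [Fy|Gy]].
      by apply: sub_sumsetl; [exact: cone0|apply: sub_cone; exists i].
    by apply: sub_sumsetr; [exact: cone0|apply: sub_cone; exists i].
move=> [u /(cone_bigcup Fc)[l [a [la <-]]]
  [v /(cone_bigcup Gc)[m [b [mb <-]]] <-]].
by exists l, m, a, b.
Qed.

End ConicFamily.

(** Off [D] the multiplier is zero, which forces the term [a i] to be zero, so the restricted sum
    loses nothing. *)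
Lemma msum_conic {R : realType} {n N : nat} (D : set 'I_N)
    (F : 'I_N -> set 'rV[R]_n) (l : 'rV[R]_N) (a : 'I_N -> 'rV[R]_n) :
  conic_family D F l a ->
  (\msum_(i < N | i \in D) scaleset (l 0 i) (F i)) (\sum_i a i).
Proof.
move=> [_ lD Fa]; rewrite (bigID (mem D))/= [X in _ + X]big1 => [|i].
  by rewrite addr0; apply: msum_sum => i _; exact: Fa.
by move=> /negP; rewrite in_setE => /lD li; have := Fa i;
  rewrite li /scaleset eqxx.
Qed.

(** * Stationarity *)

Section Stationarity.
Context {R : realType} {n p q m : nat} (P : mpec R n p q m) (k : 'rV[R]_n).

Lemma Delta_convex_cone : convex_cone (Delta P k).
Proof. by do ![apply: convex_cone_sumset]; exact: convex_cone_cone. Qed.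

Lemma Delta0 : Delta P k 0.
Proof. by do ![apply: sumset0]; exact: cone0. Qed.

(** Each generating set lies in [Delta], since every other summand contains the origin. *)
Lemma polar_Delta : polar (Delta P k) `<=` linearized_cone P k.
Proof.
have c0 (A : set 'rV[R]_n) : cone A 0 := cone0 (A := A).
move=> u uD; do ![split]=> a Aa; apply: uD.
- by do 4![apply: sub_sumsetl => //]; exact: sub_cone.
- do 3![apply: sub_sumsetl => //]; apply: sub_sumsetr => //; exact: sub_cone.
- do 2![apply: sub_sumsetl => //]; apply: sub_sumsetr; last exact: sub_cone.
  by do ![apply: sumset0]; exact: cone0.
- apply: sub_sumsetl => //; apply: sub_sumsetr; last exact: sub_cone.
  by do ![apply: sumset0]; exact: cone0.
- apply: sub_sumsetr; last exact: sub_cone.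
  by do ![apply: sumset0]; exact: cone0.
Qed.

Lemma Delta_GS_stationary (xi : 'rV[R]_n) : feasible P k ->
  tan_subdiff (objF P) k xi -> Delta P k (- xi) -> GS_stationary P k.
Proof.
move=> feas Jxi.
case=> _ [_ [_ [x1 Ax1 [x2 Ax2 <-]] [x3 Ax3 <-]] [x4 Ax4 <-]] [x5 Ax5 sumE].
have tc N (f : 'I_N -> 'rV[R]_n -> R) i :
    convex_set (tan_subdiff (f i) k) by exact: tan_subdiff_convex.
have [l1 [a1 [f1 x1E]]] := cone_bigcup (tc _ _) Ax1.
have [l2 [m2 [a2 [b2 [fa2 fb2 x2E]]]]] := cone_bigcupU (tc _ _) (tc _ _) Ax2.
have [l3 [m3 [a3 [b3 [fa3 fb3 x3E]]]]] := cone_bigcupU (tc _ _) (tc _ _) Ax3.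
have [l4 [m4 [a4 [b4 [fa4 fb4 x4E]]]]] := cone_bigcupU (tc _ _) (tc _ _) Ax4.
have [l5 [m5 [a5 [b5 [fa5 fb5 x5E]]]]] := cone_bigcupU (tc _ _) (tc _ _) Ax5.
(* Subgradients of the negated components arise twice: on [Theta] and [Omega] for [compG], on
   [Upsilon] and [Omega] for [compH]. Each pair is merged into one multiplier. *)
have fG := conic_familyD (tc _ _) fb3 fa5.
have fH := conic_familyD (tc _ _) fb4 fb5.
split=> //.
exists l1, l2, (m3 + l5), (m4 + m5), m2, l3, l4; split; last split.
- exists (xi + x1 + x2 + \sum_i ((b3 i + a5 i) + (b4 i + b5 i))).
    exists (xi + x1 + x2).
      exists (xi + x1); last exists x2 => //.
        by exists xi => //; exists x1 => //; rewrite -x1E; exact: msum_conic.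
      rewrite -x2E -big_split/=; apply: msum_sum => j _.
      by case: fa2 fb2 => [_ _ fa] [_ _ fb]; exists (a2 j) => //; exists (b2 j).
    exists (\sum_i ((b3 i + a5 i) + (b4 i + b5 i))) => //.
    apply: msum_sum => i _; case: fG fH => [_ _ fa] [_ _ fb].
    by exists (b3 i + a5 i) => //; exists (b4 i + b5 i).
  exists (\sum_i (a3 i + a4 i)).
    apply: msum_sum => i _; case: fa3 fa4 => [_ _ fa] [_ _ fb].
    by exists (a3 i) => //; exists (a4 i).
  move: sumE; rewrite -x3E -x4E -x5E !big_split/= => /rowP sumE.
  by apply/rowP => i; have := sumE i; rewrite !mxE; lra.
- case: f1 fa2 fb2 fa3 fa4 fG fH => l10 _ _ [l20 _ _] [m20 _ _] [l30 _ _].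
  by move=> [l40 _ _] [g0 _ _] [h0 _ _]; split=> i.
(* Multipliers vanish off their index sets, and the signs of [compG] and [compH] make [Theta],
   [Omega] and [Upsilon] pairwise disjoint. *)
- case: fa3 fa4 fG fH => _ lG _ [_ lH _] [_ mG _] [_ mH _].
  split=> i.
  + by move=> [G0 _]; split; [apply: lG|apply: mG] => [[]|[][]]; lra.
  + by move=> [_ H0]; split; [apply: lH|apply: mH] => [[]|[][]]; lra.
  + by move=> [G0 H0]; split; [apply: lG|apply: lH] => -[]; lra.
Qed.

End Stationarity.

Theorem theorem2 (R : realType) (n p q m : nat) (P : mpec R n p q m)
    (k : 'rV[R]_n)
    (Omega_neq0 : Omega P k !=set0)
    (k_sol : local_solution P k)
    (J_tconv : tangentially_convex (objF P) k)
    (J_lip : locally_lipschitz_at (objF P) k)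
    (neg_tconv : negated_tangentially_convex P k)
    (acq : GS_ACQ P k)
    (Delta_closed : closed (Delta P k)) :
  GS_stationary P k.
Proof.
have [feas kmin] := k_sol; have [_ _ acqT] := acq.
have [[xi [Jxi Dxi]]|noxi] :=
  pselect (exists xi, tan_subdiff (objF P) k xi /\ Delta P k (- xi)).
  exact: Delta_GS_stationary Jxi Dxi.
have [xi0 Jxi0 _] := tan_subdiff_max 0 J_tconv.
have [||u Du uJ] := @strict_separation _ _ (tan_subdiff (objF P) k) (Delta P k)
    (@tan_subdiff_compact _ _ _ _) _ (@tan_subdiff_convex _ _ _ _) Delta_closed
    (Delta_convex_cone P k) (Delta0 P k).
- by exists xi0.
- by move=> xi Jxi Dxi; apply: noxi; exists xi.
have [xi Jxi xiu] := tan_subdiff_max u J_tconv.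
have := uJ _ Jxi; rewrite dotvC xiu ltNge => /negP[].
exact: contingent_dir_deriv_ge0 J_lip kmin (J_tconv.1 u)
  (acqT _ (polar_Delta Du)).
Qed.
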